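(* For every integer $r\ge2$, $$C_{(r-1)}=\rho_r,\qquad\text{where}\qquad \rho_r=\frac1{r!}\left[(-1)^r+\sum_{j=3}^{r}(-1)^{r+j}\zeta(j-1)\right],$$ and consequently $$C_r-\rho_r=\sum_{\substack{\nu\vdash r-1\\ \ell(\nu)\ge2}}C_\nu.$$
   Context: $\zeta$ is the Riemann zeta function. For a partition $\nu$, $\ell(\nu)$ is its number of positive parts and $\nu\vdash N$ means that its parts sum to $N$; $(r-1)$ denotes the one-part partition of $r-1$. Let $$\mathcal H(u)=\prod_{q=1}^\infty\frac{q}{q+1}\left(1+\frac{e^{u/q}-1}{u}\right)$$ (with the removable singularity at $u=0$ filled in; the product converges locally uniformly near $u=0$), and let $C_r=[u^{r-1}]\mathcal H(u)$ be the coefficient of $u^{r-1}$ in its Taylor expansion at $0$. For $k,q\ge1$ put $a_k(q)=\dfrac{1}{(k+1)!\,q^k(q+1)}$. For a partition $\nu=(\nu_1,\ldots,\nu_d)\vdash r-1$, let $m_j(\nu)$ be the multiplicity of the part $j$ in $\nu$, and define $$C_\nu=\frac{1}{\prod_{j\ge1}m_j(\nu)!}\sum_{\substack{q_1,\ldots,q_d\ge1\\ q_a\ne q_b\ (a\ne b)}}\ \prod_{s=1}^d a_{\nu_s}(q_s),$$ an absolutely convergent sum over ordered $d$-tuples of distinct positive integers. ($\rho_r$ is called Segovia's hook constant.) *)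

(* Defs.v *)
From mathcomp Require Import all_boot all_order all_algebra.
From mathcomp Require Import all_classical all_reals all_analysis.

Set Implicit Arguments.
Unset Strict Implicit.
Unset Printing Implicit Defensive.

Import Order.TTheory GRing.Theory Num.Theory.
Import numFieldNormedType.Exports.

Local Open Scope classical_set_scope.
Local Open Scope ring_scope.

(* Dirichlet series: this is the Riemann zeta function for real s > 1 only. *)
Definition riemann_zeta (R : realType) (s : R) : R :=
  limn (fun N => \sum_(1 <= n < N) n%:R `^ (- s)).

(* The q-th factor of H; at u = 0 the quotient (e^(u/q) - 1) / u is replaced
   by its limit 1/q. *)
Definition calH_factor (R : realType) (q : nat) (u : R) : R :=
  q%:R / q.+1%:R *
  (1 + (if u == 0 then q%:R^-1 else (expR (u / q%:R) - 1) / u)).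

Definition calH (R : realType) (u : R) : R :=
  limn (fun N => \prod_(1 <= q < N) calH_factor q u).

Definition taylor_coef (R : realType) (f : R -> R) (n : nat) : R :=
  derive1n n f 0 / n`!%:R.

Definition Cr (R : realType) (r : nat) : R := taylor_coef (@calH R) r.-1.

Definition ak (R : realType) (k q : nat) : R :=
  (k.+1`!%:R * q%:R ^+ k * q.+1%:R)^-1.

(* A partition is the nonincreasing sequence of its positive parts, so that
   [size nu] is its number of parts. *)
Definition is_partition (N : nat) (nu : seq nat) : bool :=
  [&& sorted geq nu, 0%N \notin nu & sumn nu == N].

Lemma finite_partitions (N : nat) : finite_set [set nu | is_partition N nu].
Proof.
pose T := {bseq N of 'I_N.+1}.
apply: (@sub_finite_set _ _ [set map val (val t) | t in [set: T]]); last first.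
  exact/finite_image/finite_finset.
move=> nu /= /and3P[_ nu0 /eqP sN].
have len : (size nu <= N)%N.
  rewrite -sN; elim: nu nu0 {sN} => [//|x s IH] /=.
  rewrite inE negb_or => /andP[x0 /IH]; rewrite -add1n => le_s.
  by rewrite leq_add// lt0n eq_sym.
have lex x : x \in nu -> (x <= N)%N.
  move: sN => <- {len nu0}; elim: nu => [//|y s IH] /=; rewrite inE.
  by case/orP => [/eqP ->|/IH h]; rewrite ?leq_addr// (leq_trans h)// leq_addl.
have len' : (size (map (@inord N) nu) <= N)%N by rewrite size_map.
exists (Bseq len') => //=; rewrite -map_comp map_id_in// => x xnu /=.
by rewrite inordK// ltnS lex.
Qed.

Definition multiplicity (j : nat) (nu : seq nat) : nat := count_mem j nu.

Definition distinct_positive (d : nat) : set (d.-tuple nat) :=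
  [set q : d.-tuple nat | uniq q /\ forall s : 'I_d, (0 < tnth q s)%N].

(* The terms of the sum are nonnegative, so the absolutely convergent sum over
   tuples is the supremum [esum] of its finite partial sums. The product over
   all j >= 1 stops at |nu|, beyond which multiplicities vanish. *)
Definition Cpart (R : realType) (nu : seq nat) : R :=
  (\prod_(1 <= j < (sumn nu).+1) (multiplicity j nu)`!%:R)^-1 *
  fine (\esum_(q in @distinct_positive (size nu))
          (\prod_(s < size nu) ak R (nth 0%N nu s) (tnth q s))%:E).

Definition rho (R : realType) (r : nat) : R :=
  r`!%:R^-1 * ((-1) ^+ r +
    \sum_(3 <= j < r.+1) (-1) ^+ (r + j) * riemann_zeta (j.-1%:R : R)).

(* Main.v *)
Require Import Defs.
From mathcomp Require Import all_boot all_order all_algebra finmap.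
From mathcomp Require Import all_classical all_reals all_analysis.
From mathcomp Require Import ring zify.

Set Implicit Arguments.
Unset Strict Implicit.
Unset Printing Implicit Defensive.

Import Order.TTheory GRing.Theory Num.Theory.
Import numFieldNormedType.Exports.

Local Open Scope classical_set_scope.
Local Open Scope ring_scope.

(** Why the theorem holds.

    Expanding the exponential, the q-th factor of H(u) is the entire series
    1 + a_1(q) u + a_2(q) u^2 + ..., so that multiplying out the product over
    q, a monomial u^n arises by choosing finitely many distinct indices q and
    for each of them a positive exponent; the exponents form a partition nu of
    n, and the choices belonging to nu add up to C_nu, the factorials
    m_j(nu)! accounting for the order among equal exponents. Hence C_r is the
    sum of C_nu over all the partitions nu of r - 1, and the second claim is
    the first one after removing the only one-part partition.

    The expansion is proved first for the product over q <= N
    ([partial_prodE]), by induction on N. The index N + 1 occurs at most once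
    in a tuple of distinct indices; removing it, together with the part j that
    it carries, gives a recurrence for the truncated C_nu
    ([Cpart_upto_rec]). Summed over the partitions of n, it says that the
    coefficients of the partial products are multiplied by the series of the
    next factor ([partsum_rec]), which matches the product rule for entire
    series ([psum_cauchy_prod]).

    For the passage to the limit in N, all the coefficients c_n(N) are
    nonnegative and nondecreasing in N, with limit c_n. For rho >= 0 the
    partial products H_N(rho) are at most exp(exp rho), and
    (c_n - c_n(N)) rho^n is a single term of a nonnegative series whose sum is
    at most H(rho) - H_N(rho) ([partsum_tail]). With rho = 2|u| this bounds
    the coefficients of the difference by a geometric series and gives
    H_N(u) --> sum c_n u^n for every real u ([cvg_partial_prod]). So H is the
    sum of an entire series, which may be differentiated term by term, and its
    Taylor coefficients are the c_n. Finally c_n is the sum of the C_nu,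
    because the truncated sums over tuples exhaust the infinite one
    ([cvg_Cpart]).

    For the one-part partition, let S_k be the sum over q >= 1 of
    1 / (q^k (q + 1)). Then S_1 = 1 by telescoping, and
    1 / (q^(k+1) (q+1)) + 1 / (q^k (q+1)) = 1 / q^(k+1) gives
    S_(k+1) + S_k = zeta(k + 1), whose solution is (k + 1)! rho_(k+1)
    ([Cpart_one_part]). *)

(** * Sums over tuples of distinct indices, and partitions *)

Section Combinatorics.
Context {R : realType}.

(** The sum over tuples of distinct entries of [A], organised by the choice of
    the first entry: this form makes the recurrence in [A] a plain induction
    on [nu]. *)
Fixpoint distinct_sum (nu A : seq nat) : R :=
  if nu is k :: nu' then
    \sum_(q <- A) ak R k q * distinct_sum nu' (rem q A)
  else 1.

Lemma geq_trans : transitive geq.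
Proof. by move=> a b c /= h1 h2; exact: leq_trans h2 h1. Qed.

Lemma rem_sorted_head k nu : sorted geq (k :: nu) -> k \in nu ->
  k :: rem k nu = nu.
Proof.
case: nu => [//|l nu] /= /andP[lk s_nu]; rewrite inE eq_sym.
case: eqP => [-> //|/eqP nkl /= knu].
have /allP/(_ _ knu) /= kl : all (geq l) nu.
  exact: order_path_min geq_trans s_nu.
by move: lk kl nkl => /=; lia.
Qed.

(** A tuple of distinct entries uses the new index [x] at most once. If it does,
    say for a part equal to [j], any of the [count_mem j nu] places carrying
    [j] may be the one; equal parts being adjacent in a sorted list, they all
    leave the same list [rem j nu] behind. The list [J] bounds the range of [j]
    by something that stays fixed during the induction. *)
Lemma distinct_sum_cons (J nu A : seq nat) (x : nat) :
  uniq J -> {subset nu <= J} -> sorted geq nu -> x \notin A ->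
  distinct_sum nu (x :: A) = distinct_sum nu A +
    \sum_(j <- J) (count_mem j nu)%:R * ak R j x * distinct_sum (rem j nu) A.
Proof.
move=> uJ; elim: nu A => [|k nu IH] A sJ s_nu xA.
  by rewrite /= big1 ?addr0// => j _; rewrite !mul0r.
have sJ' : {subset nu <= J} by move=> y ynu; apply: sJ; rewrite inE ynu orbT.
have kJ : k \in J by apply: sJ; rewrite inE eqxx.
have s_nu' : sorted geq nu by move: s_nu => /=; apply: path_sorted.
have -> : \sum_(j <- J) (count_mem j (k :: nu))%:R * ak R j x *
     distinct_sum (rem j (k :: nu)) A =
   ak R k x * distinct_sum nu A + \sum_(j <- J) (count_mem j nu)%:R *
      ak R j x * distinct_sum (k :: rem j nu) A.
  have -> : ak R k x * distinct_sum nu A = \sum_(j <- J)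
      (k == j)%:R * ak R j x * distinct_sum nu A.
    rewrite (bigD1_seq k)//= eqxx mul1r big1 ?addr0// => j /negPf.
    by rewrite eq_sym => ->; rewrite !mul0r.
  rewrite -big_split /=; apply: eq_bigr => j _.
  rewrite -[\sum_(q <- A) _]/(distinct_sum (k :: rem j nu) A).
  rewrite natrD 2!mulrDl; case: (eqVneq k j) => [<-|kj].
    congr (_ + _); have [knu|/count_memPn ->] := boolP (k \in nu).
      by have -> := rem_sorted_head s_nu knu.
    by rewrite !mul0r.
  by rewrite !mul0r.
rewrite [distinct_sum (k :: nu) (x :: A)]/= big_cons eqxx.
rewrite addrCA; congr (_ + _).
rewrite [distinct_sum (k :: nu) A]/=.
under [X in _ = _ + X]eq_bigr do rewrite /= mulr_sumr.
rewrite exchange_big /= -big_split /= big_seq [RHS]big_seq.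
apply: eq_bigr => q qA.
have xq : x != q by apply: contraNneq xA => ->.
rewrite (negPf xq) IH//; last by apply: contra xA => /mem_rem.
rewrite mulrDr mulr_sumr; congr (_ + _).
by apply: eq_bigr => j _; rewrite mulrCA.
Qed.

Definition parts (n : nat) : seq (seq nat) :=
  fset_set [set nu | is_partition n nu].

Lemma mem_parts n nu : (nu \in parts n) = is_partition n nu.
Proof.
rewrite /parts in_fset_set ?inE//; last exact: finite_partitions.
by apply/idP/idP; rewrite inE.
Qed.

Lemma parts_uniq n : uniq (parts n).
Proof. exact: fset_uniq. Qed.

Lemma part_gt0 n nu j : is_partition n nu -> j \in nu -> (0 < j)%N.
Proof.
by case/and3P => _ nu0 _ jnu; rewrite lt0n; apply: contraNneq nu0 => <-.
Qed.

Lemma mem_leq_sumn j nu : j \in nu -> (j <= sumn nu)%N.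
Proof.
elim: nu => [//|y s IH] /=; rewrite inE.
by case/orP => [/eqP ->|/IH h]; rewrite ?leq_addr// (leq_trans h)// leq_addl.
Qed.

Lemma part_leq n nu j : is_partition n nu -> j \in nu -> (j <= n)%N.
Proof. by case/and3P => _ _ /eqP <-; exact: mem_leq_sumn. Qed.

Lemma sumn_rem j nu : j \in nu -> (j + sumn (rem j nu) = sumn nu)%N.
Proof. by move=> jnu; rewrite (perm_sumn (perm_to_rem jnu)). Qed.

Lemma geq_anti : antisymmetric geq.
Proof. by move=> a b /= h; apply/eqP; rewrite eqn_leq andbC. Qed.

Lemma sort_geq_sorted s : sorted geq (sort geq s).
Proof. by apply: sort_sorted => a b; exact: leq_total. Qed.

Lemma is_partition_rem n nu j : is_partition n nu -> j \in nu ->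
  is_partition (n - j) (rem j nu).
Proof.
move=> nuP jnu; case/and3P: (nuP) => s_nu nu0 /eqP sumnu; apply/and3P; split.
- exact: (subseq_sorted geq_trans (rem_subseq _ _) s_nu).
- by apply: contra nu0 => /mem_rem.
- by rewrite -sumnu -(sumn_rem jnu) addnC addnK.
Qed.

Lemma is_partition_ins n mu j : (0 < j)%N -> (j <= n)%N ->
  is_partition (n - j) mu -> is_partition n (sort geq (j :: mu)).
Proof.
move=> j0 jn /and3P[s_mu mu0 /eqP summu]; apply/and3P; split.
- exact: sort_geq_sorted.
- by rewrite mem_sort inE negb_or mu0 andbT eq_sym -lt0n.
- by rewrite (perm_sumn (permEl (perm_sort _ _))) /= summu subnKC.
Qed.

(** Removing one part [j] is a bijection from the partitions of [n] containing
    [j] to the partitions of [n - j]; its inverse inserts [j] and sorts. *)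
Lemma perm_rem_parts n j : (0 < j)%N -> (j <= n)%N ->
  perm_eq [seq rem j nu | nu <- parts n & j \in nu] (parts (n - j)).
Proof.
move=> j0 jn; apply: uniq_perm; [|exact: parts_uniq|].
  rewrite map_inj_in_uniq ?filter_uniq ?parts_uniq//.
  move=> nu mu; rewrite !mem_filter !mem_parts.
  move=> /andP[jnu /and3P[s_nu _ _]] /andP[jmu /and3P[s_mu _ _]] e.
  apply: (sorted_eq geq_trans geq_anti s_nu s_mu).
  by rewrite (permPl (perm_to_rem jnu)) e perm_sym; exact: perm_to_rem.
move=> mu; rewrite mem_parts; apply/mapP/idP => [[nu]|muP].
  by rewrite mem_filter mem_parts => /andP[jnu nuP] ->; exact: is_partition_rem.
exists (sort geq (j :: mu)).
  by rewrite mem_filter mem_sort mem_head mem_parts is_partition_ins.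
case/and3P: (muP) => s_mu _ _; apply: (sorted_eq geq_trans geq_anti s_mu).
  exact: (subseq_sorted geq_trans (rem_subseq _ _) (sort_geq_sorted _)).
rewrite -(perm_cons j) perm_sym.
have jin : j \in sort geq (j :: mu) by rewrite mem_sort mem_head.
by rewrite -(permPl (perm_to_rem jin)) perm_sort.
Qed.

Definition mult_fact (nu : seq nat) : R :=
  \prod_(1 <= j < (sumn nu).+1) (multiplicity j nu)`!%:R.

(** A common range for the products attached to [nu] and to [rem j nu]. *)
Lemma mult_factE (nu : seq nat) M : (sumn nu <= M)%N ->
  mult_fact nu = \prod_(1 <= j < M.+1) (multiplicity j nu)`!%:R.
Proof.
move=> nuM; rewrite /mult_fact [RHS](big_cat_nat _ (n := (sumn nu).+1))//=.
rewrite [X in _ * X]big_nat_cond [X in _ * X]big1 ?mulr1// => j.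
rewrite andbT /multiplicity => /andP[jnu _].
suff /count_memPn -> : j \notin nu by [].
by apply/negP => /mem_leq_sumn; rewrite leqNgt jnu.
Qed.

Lemma mult_fact_gt0 nu : 0 < mult_fact nu.
Proof. by apply: prodr_gt0 => j _; rewrite ltr0n fact_gt0. Qed.

Lemma mult_fact_rem j nu : (0 < j)%N -> j \in nu ->
  mult_fact nu = (count_mem j nu)%:R * mult_fact (rem j nu).
Proof.
move=> j0 jnu; rewrite (@mult_factE (rem j nu) (sumn nu)); last first.
  by rewrite -(sumn_rem jnu) leq_addl.
have jin : j \in index_iota 1 (sumn nu).+1.
  by rewrite mem_index_iota j0 ltnS mem_leq_sumn.
rewrite /mult_fact !(bigD1_seq j)//= ?iota_uniq// mulrA; congr (_ * _).
  rewrite -natrM /multiplicity; congr _%:R.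
  rewrite (permP (perm_to_rem jnu)) /= eqxx add1n.
  by rewrite factS.
apply: eq_bigr => i ij; rewrite /multiplicity.
by rewrite (permP (perm_to_rem jnu)) /= eq_sym (negPf ij) add0n.
Qed.

(** Decreasing, so that passing from [N] to [N.+1] adds a head. *)
Definition downto (N : nat) : seq nat := rev (iota 1 N).

Lemma downtoS N : downto N.+1 = N.+1 :: downto N.
Proof. by rewrite /downto -[in LHS](addn1 N) iotaD rev_cat /= add1n. Qed.

Lemma mem_downto N q : (q \in downto N) = (0 < q <= N)%N.
Proof. by rewrite mem_rev mem_iota add1n ltnS. Qed.

Definition Cpart_upto (N : nat) (nu : seq nat) : R :=
  (mult_fact nu)^-1 * distinct_sum nu (downto N).

(** These turn out to be the Taylor coefficients of the N-th partial product. *)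
Definition partsum (N n : nat) : R := \sum_(nu <- parts n) Cpart_upto N nu.

(** The multiplicity of [j] in [distinct_sum_cons] is absorbed by the ratio
    [mult_fact nu / mult_fact (rem j nu)]: this is why dividing by the
    factorials yields a recurrence without multiplicities. *)
Lemma Cpart_upto_rec n nu N : is_partition n nu ->
  Cpart_upto N.+1 nu = Cpart_upto N nu +
   \sum_(1 <= j < n.+1 | j \in nu) ak R j N.+1 * Cpart_upto N (rem j nu).
Proof.
move=> nuP; rewrite /Cpart_upto downtoS.
rewrite (@distinct_sum_cons (index_iota 1 n.+1))//; first last.
- by rewrite mem_downto ltnn andbF.
- by case/and3P: nuP.
- move=> j jnu; rewrite mem_index_iota ltnS (part_leq nuP)//.
  by rewrite (part_gt0 nuP).
- exact: iota_uniq.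
rewrite mulrDr; congr (_ + _); rewrite mulr_sumr [RHS]big_mkcond /=.
apply: eq_bigr => j _; case: ifPn => [jnu|/count_memPn ->]; last first.
  by rewrite !mul0r mulr0.
rewrite (mult_fact_rem (part_gt0 nuP jnu) jnu).
have c0 : (count_mem j nu)%:R != 0 :> R.
  by rewrite pnatr_eq0 -lt0n -has_count has_pred1.
have w0 := lt0r_neq0 (mult_fact_gt0 (rem j nu)).
by field; rewrite c0 w0.
Qed.

Definition factor_coef (q k : nat) : R := if k == 0%N then 1 else ak R k q.

(** The truncated sums over partitions obey the rule for multiplying a series
    by the one of the factor of index [N.+1]: exchange the sums over [nu] and
    [j] in [Cpart_upto_rec] and reindex by [perm_rem_parts]. *)
Lemma partsum_rec N n : partsum N.+1 n =
  \sum_(i < n.+1) partsum N (n - i) * factor_coef N.+1 i.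
Proof.
rewrite -(big_mkord xpredT (fun i => partsum N (n - i) * factor_coef N.+1 i)).
rewrite big_ltn//= subn0 {2}/factor_coef /= mulr1 /partsum.
under eq_big_seq => nu.
  rewrite mem_parts => /(Cpart_upto_rec N) ->.
  over.
rewrite big_split; congr (_ + _) => /=.
under eq_bigr do rewrite big_mkcond /=.
rewrite exchange_big /= !big_nat; apply: eq_bigr => j /andP[j0 jn].
rewrite -big_mkcond /= -(perm_big _ (perm_rem_parts j0 jn)) /=.
rewrite big_map big_filter mulr_suml; apply: eq_bigr => nu _.
by rewrite mulrC /factor_coef; case: j j0 {jn}.
Qed.

Lemma parts0 : parts 0 = [:: [::]].
Proof.
apply: perm_small_eq => //; apply: uniq_perm; rewrite ?parts_uniq// => nu.
rewrite mem_parts inE /is_partition; case: nu => [//|a nu] /=.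
by rewrite inE negb_or addn_eq0 eq_sym; case: (a == 0%N); rewrite ?andbF.
Qed.

Lemma partsum0 n : partsum 0 n = (n == 0%N)%:R.
Proof.
rewrite /partsum; case: n => [|n].
  rewrite parts0 big_seq1 /Cpart_upto /mult_fact /= big_geq//.
  by rewrite invr1 mulr1.
rewrite big_seq big1// => -[|k nu]; rewrite mem_parts.
  by rewrite /is_partition.
by rewrite /Cpart_upto /= big_nil mulr0.
Qed.

Lemma ak_ge0 k q : 0 <= ak R k q.
Proof. by rewrite invr_ge0 !mulr_ge0 ?exprn_ge0. Qed.

Lemma distinct_sum_ge0 nu A : 0 <= distinct_sum nu A.
Proof.
elim: nu A => [//|k nu IH] A /=.
by apply: sumr_ge0 => q _; rewrite mulr_ge0 ?ak_ge0.
Qed.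

Lemma Cpart_upto_ge0 N nu : 0 <= Cpart_upto N nu.
Proof.
by rewrite mulr_ge0 ?distinct_sum_ge0// invr_ge0 ltW// mult_fact_gt0.
Qed.

Lemma partsum_ge0 N n : 0 <= partsum N n.
Proof. by apply: sumr_ge0 => nu _; exact: Cpart_upto_ge0. Qed.

Lemma distinct_sum_le_cons nu x A : x \notin A ->
  distinct_sum nu A <= distinct_sum nu (x :: A).
Proof.
elim: nu A => [//|k nu IH] A xA /=.
rewrite big_cons -[leLHS]add0r lerD//.
  by rewrite mulr_ge0 ?ak_ge0 ?distinct_sum_ge0.
rewrite big_seq [leRHS]big_seq; apply: ler_sum => q qA.
rewrite ler_wpM2l ?ak_ge0//.
have xq : x != q by apply: contraNneq xA => ->.
by rewrite (negPf xq) IH//; apply: contra xA => /mem_rem.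
Qed.

Lemma Cpart_upto_nd nu : nondecreasing_seq (Cpart_upto^~ nu).
Proof.
apply/nondecreasing_seqP => N.
rewrite ler_wpM2l ?invr_ge0 ?(ltW (mult_fact_gt0 _))//.
by rewrite downtoS distinct_sum_le_cons// mem_downto ltnn andbF.
Qed.

Lemma partsum_nd n : nondecreasing_seq (partsum^~ n).
Proof. by move=> N M NM; apply: ler_sum => nu _; exact: Cpart_upto_nd. Qed.

End Combinatorics.

(** * Entire power series *)

Section EntireSeries.
Context {R : realType}.
Implicit Types c d : R ^nat.

(** Infinite radius of convergence, in the form of Cauchy estimates: it is
    stable under differentiation and products by elementary bounds. *)
Definition entire c :=
  forall r : R, 0 <= r -> exists M, forall n, `|c n| * r ^+ n <= M.

Definition psum c (x : R) : R := limn (pseries c x).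

(** The radius [2 * `|x|] makes the terms at [x] at most [M / 2 ^ n]. *)
Lemma psum_bound c x M : (forall n, `|c n| * (2 * `|x|) ^+ n <= M) ->
  cvgn (pseries c x) /\ `|psum c x| <= 2 * M.
Proof.
move=> cM.
have h0 : `|2^-1 : R| < 1 by rewrite ger0_norm// invf_lt1// ltr1n.
pose u := fun n => `|c n * x ^+ n|.
have ug n : u n <= geometric M 2^-1 n.
  rewrite /u /geometric /= normrM normrX exprVn ler_pdivlMr ?exprn_gt0//.
  by rewrite -mulrA -exprMn [_ * 2]mulrC.
have cg := @is_cvg_geometric_series _ M _ h0.
have u0 n : 0 <= u n by exact: normr_ge0.
have cu : cvgn (series u).
  by apply: series_le_cvg cg => // n; rewrite (le_trans (u0 n)).
have cn : cvgn [normed pseries c x] by exact: cu.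
split; first exact: normed_cvg.
apply: le_trans (lim_series_norm cn) _.
apply: le_trans (lim_series_le cu cg ug) _.
rewrite (cvg_lim _ (@cvg_geometric_series _ M _ h0))//.
by rewrite le_eqVlt; apply/orP; left; apply/eqP; field.
Qed.

Lemma entire_cvg c x : entire c -> cvgn (pseries c x).
Proof.
move=> /(_ (2 * `|x|)) []; first by rewrite mulr_ge0.
by move=> M /psum_bound [].
Qed.

Lemma natr_le_exp2 n : n.+1%:R <= 2 ^+ n :> R.
Proof. by rewrite -natrX ler_nat; apply: ltn_expl. Qed.

(** The factor [n.+1] is absorbed by doubling the radius. *)
Lemma entire_diffs c : entire c -> entire (pseries_diffs c).
Proof.
move=> ec r r0; have r1 : 0 <= r + 1 by rewrite addr_ge0.
have [|M cM] := ec (2 * (r + 1)); first by rewrite mulr_ge0.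
exists M => n; apply: le_trans (cM n.+1).
rewrite /pseries_diffs normrM ger0_norm// mulrAC mulrC.
rewrite ler_wpM2l// exprMn ler_pM ?exprn_ge0//.
  by apply: le_trans (natr_le_exp2 _) _; rewrite ler_eXn2l// ltr1n.
apply: (@le_trans _ _ ((r + 1) ^+ n)); first by rewrite lerXn2r// lerDl.
by rewrite exprS ler_peMl ?exprn_ge0// lerDr.
Qed.

Lemma derive1n_psum c n : entire c ->
  derive1n n (psum c) = psum (iter n (@pseries_diffs R) c).
Proof.
move=> ec; have ei k : entire (iter k (@pseries_diffs R) c).
  by elim: k => [//|k IH] /=; exact: entire_diffs.
elim: n => [//|n IH]; rewrite derive1nS IH iterS.
apply/funext => x; rewrite derive1E.
have [] := @pseries_snd_diffs R (iter n (@pseries_diffs R) c) (`|x| + 1) x.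
- exact/entire_cvg.
- exact/entire_cvg/entire_diffs.
- exact/entire_cvg/entire_diffs/entire_diffs.
- by rewrite [X in _ < X]ger0_norm ?addr_ge0// ltrDl.
by move=> _ dE; exact: dE.
Qed.

Lemma iter_diffs c n k :
  k`!%:R * iter n (@pseries_diffs R) c k = (n + k)`!%:R * c (n + k)%N.
Proof.
elim: n k => [//|n IH] k; rewrite iterS /pseries_diffs mulrA.
by rewrite -natrM mulnC -factS IH addnS.
Qed.

Lemma psum0 c : psum c 0 = c 0%N.
Proof.
apply/cvg_lim => //; rewrite -cvg_shiftS /pseries /series /=.
under eq_fun.
  move=> n; rewrite big_nat_recl//= expr0 mulr1 big1.
    by rewrite addr0; over.
  by move=> i _; rewrite expr0n mulr0.
exact: cvg_cst.
Qed.

Lemma taylor_coef_psum c n : entire c -> taylor_coef (psum c) n = c n.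
Proof.
move=> ec; rewrite /taylor_coef derive1n_psum// psum0.
have := iter_diffs c n 0; rewrite addn0 mul1r => ->.
by rewrite mulrAC divff ?mul1r// pnatr_eq0 -lt0n fact_gt0.
Qed.

Lemma psumB c d x : entire c -> entire d ->
  psum (fun n => c n - d n) x = psum c x - psum d x.
Proof.
move=> ec ed; rewrite -lim_seriesB; try exact: entire_cvg.
congr (limn (series _)); apply/funext => n /=.
by rewrite /mk_sequence mulrBl.
Qed.

Lemma term_le_psum c x n : entire c -> (forall k, 0 <= c k) -> 0 <= x ->
  c n * x ^+ n <= psum c x.
Proof.
move=> ec c0 x0.
have nd : nondecreasing_seq (pseries c x).
  by apply/nondecreasing_series => k _ _; rewrite mulr_ge0 ?exprn_ge0.
apply: le_trans (nondecreasing_cvgn_le nd (@entire_cvg _ x ec) n.+1).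
rewrite /pseries seriesSr /= lerDr.
by apply: sumr_ge0 => k _; rewrite mulr_ge0 ?exprn_ge0.
Qed.

Definition cauchy_prod c d : R ^nat :=
  fun n => \sum_(i < n.+1) c (n - i)%N * d i.

Lemma entire_cauchy_prod c d : entire c -> entire d -> entire (cauchy_prod c d).
Proof.
move=> ec ed r r0; have r20 : 0 <= 2 * r by rewrite mulr_ge0.
have [M cM] := ec _ r20; have [L dL] := ed _ r20.
exists (M * L) => n.
have ML0 : 0 <= M * L.
  by rewrite mulr_ge0//; [apply: le_trans (cM 0%N)|apply: le_trans (dL 0%N)];
    rewrite mulr_ge0.
have p2 k : 0 < 2 ^+ k :> R by rewrite exprn_gt0.
rewrite -(ler_pM2r (p2 n)) -mulrA -exprMn [r * 2]mulrC.
apply: le_trans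
    (_ : (\sum_(i < n.+1) `|c (n - i)%N * d i|) * (2 * r) ^+ n <= _).
  by rewrite ler_wpM2r ?exprn_ge0// ler_norm_sum.
rewrite mulr_suml; apply: le_trans (_ : \sum_(i < n.+1) M * L <= _).
  apply: ler_sum => i _; have ni : (i <= n)%N by rewrite -ltnS.
  have -> : (2 * r) ^+ n = (2 * r) ^+ (n - i) * (2 * r) ^+ i.
    by rewrite -exprD subnK.
  rewrite normrM mulrACA.
  by rewrite ler_pM// mulr_ge0 ?exprn_ge0.
by rewrite sumr_const card_ord -[leLHS]mulr_natr ler_wpM2l// natr_le_exp2.
Qed.

(** Both sides sum [F] over the triangle [i + j < N]. *)
Lemma sum_antidiag (F : nat -> nat -> R) N :
  \sum_(0 <= n < N) \sum_(i < n.+1) F (n - i)%N i =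
  \sum_(0 <= i < N) \sum_(0 <= j < N | (i + j < N)%N) F j i.
Proof.
under eq_bigr do rewrite -(big_mkord xpredT (fun i => F (_ - i)%N i)).
transitivity (\sum_(0 <= n < N) \sum_(0 <= i < N | (i <= n)%N) F (n - i)%N i).
  rewrite !big_nat; apply: eq_bigr => n /andP[_ nN].
  by rewrite (big_nat_widen _ _ _ _ _ nN).
rewrite (exchange_big_dep xpredT)//= !big_nat; apply: eq_bigr => i /andP[_ iN].
transitivity (\sum_(i <= n < N) F (n - i)%N i).
  rewrite [RHS](big_nat_widenl _ 0)//; exact: eq_bigl.
rewrite -{1}(add0n i) big_addn.
rewrite (big_nat_widen _ _ N) ?leq_subr//=.
by apply: eq_big => [j|j _]; rewrite ?addnK// ltn_subRL.
Qed.

(** The product of the N-th partial sums exceeds the N-th partial sum of the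
    product series by the terms with [i, j < N <= i + j]. There are at most
    [N ^ 2 <= 4 ^ N] of them, each of size at most [M * L / 8 ^ N] by the
    Cauchy estimates at radius [8 * `|x|], so the difference tends to 0. *)
Lemma psum_cauchy_prod c d x : entire c -> entire d ->
  psum (cauchy_prod c d) x = psum c x * psum d x.
Proof.
move=> ec ed; have r0 : 0 <= 8 * `|x| by rewrite mulr_ge0.
have [M cM] := ec _ r0; have [L dL] := ed _ r0.
have M0 : 0 <= M by apply: le_trans (cM 0%N); rewrite mulr_ge0.
have L0 : 0 <= L by apply: le_trans (dL 0%N); rewrite mulr_ge0.
have e8 (e : R ^nat) K n : `|e n| * (8 * `|x|) ^+ n <= K ->
    `|e n * x ^+ n| <= K * 8^-1 ^+ n.
  move=> h; rewrite exprVn ler_pdivlMr ?exprn_gt0//.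
  by rewrite normrM normrX -mulrA -exprMn [_ * 8]mulrC.
pose u n := c n * x ^+ n; pose v n := d n * x ^+ n.
have defect N : pseries c x N * pseries d x N - pseries (cauchy_prod c d) x N =
    \sum_(0 <= i < N) \sum_(0 <= j < N | (N <= i + j)%N) u j * v i.
  have -> : pseries (cauchy_prod c d) x N =
      \sum_(0 <= n < N) \sum_(i < n.+1) u (n - i)%N * v i.
    apply: eq_bigr => n _; rewrite /mk_sequence /cauchy_prod mulr_suml.
    apply: eq_bigr => i _.
    have ni : (i <= n)%N by rewrite -ltnS.
    have -> : x ^+ n = x ^+ (n - i) * x ^+ i by rewrite -exprD subnK.
    by rewrite mulrACA.
  rewrite (sum_antidiag (fun a b => u a * v b)) mulrC.
  rewrite /pseries /series /= mulr_suml.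
  rewrite -sumrB; apply: eq_bigr => i _.
  rewrite mulr_sumr (bigID (fun j => (i + j < N)%N))/= addrC.
  under eq_bigr do rewrite mulrC.
  under [X in _ + X - _]eq_bigr do rewrite mulrC.
  by rewrite addrK; apply: eq_bigl => j; rewrite -leqNgt.
have bnd N : `|pseries c x N * pseries d x N - pseries (cauchy_prod c d) x N| <=
    geometric (M * L) 2^-1 N.
  rewrite defect; apply: le_trans (ler_norm_sum _ _ _) _.
  apply: (@le_trans _ _
    (\sum_(0 <= i < N) \sum_(0 <= j < N) M * L * 8^-1 ^+ N)).
    apply: ler_sum => i _; apply: le_trans (ler_norm_sum _ _ _) _.
    rewrite big_mkcond; apply: ler_sum => j _.
    case: ifPn => [Nij|_]; last first.
      by rewrite mulr_ge0 ?mulr_ge0 ?exprn_ge0.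
    rewrite normrM; apply: (@le_trans _ _ ((M * 8^-1 ^+ j) * (L * 8^-1 ^+ i))).
      by rewrite ler_pM// e8.
    rewrite mulrACA -exprD addnC ler_wpM2l ?mulr_ge0//.
    by rewrite ler_wiXn2l// invf_le1// ler1n.
  rewrite !big_const_nat subn0 !iter_addr_0 -[leLHS]mulr_natr.
  rewrite -[X in X * _ <= _]mulr_natr /geometric /= -mulrA -mulrA.
  rewrite ler_wpM2l ?mulr_ge0//.
  have -> : (2^-1 : R) ^+ N = 8^-1 ^+ N * (2 ^+ N * 2 ^+ N).
    by rewrite -!exprMn; congr (_ ^+ N); field.
  rewrite ler_wpM2l ?exprn_ge0// ler_pM//;
   by apply: le_trans (natr_le_exp2 _); rewrite ler_nat.
have cc := @entire_cvg _ x ec; have cd := @entire_cvg _ x ed.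
have cv := @entire_cvg _ x (entire_cauchy_prod ec ed).
apply/esym/eqP; rewrite -subr_eq0 -normr_le0; apply/ler_addgt0Pr => e e0.
rewrite add0r.
have cD : (fun N =>
      `|pseries c x N * pseries d x N - pseries (cauchy_prod c d) x N|)
    @ \oo --> `|psum c x * psum d x - psum (cauchy_prod c d) x|.
  by apply: cvg_norm; apply: cvgB => //; exact: cvgM.
have h0 : `|2^-1 : R| < 1 by rewrite ger0_norm// invf_lt1// ltr1n.
apply: le_trans (ltW e0).
rewrite -(cvg_lim _ cD)// -(cvg_lim _ (cvg_geometric (M * L) h0))//.
apply: ler_lim.
- by apply/cvg_ex; eexists; exact: cD.
- by apply/cvg_ex; eexists; exact: (cvg_geometric (M * L) h0).
- by near=> N; exact: bnd.
Unshelve. all: by end_near. Qed.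

End EntireSeries.

(** * The product H as an entire series *)

Section Product.
Context {R : realType}.

Lemma factor_coef_ge0 q k : 0 <= factor_coef q k :> R.
Proof. by rewrite /factor_coef; case: ifP => // _; exact: ak_ge0. Qed.

Lemma factor_coef_le q k : (0 < k)%N -> (0 < q)%N ->
  factor_coef q k <= (k`!%:R)^-1 * (q%:R * q.+1%:R)^-1 :> R.
Proof.
move=> k0 q0; rewrite /factor_coef gtn_eqF// /ak -invfM lef_pV2 ?posrE.
- rewrite mulrA ler_wpM2r// ler_pM//; first by rewrite ler_nat leq_fact.
  by case: k k0 => // k _; rewrite exprS ler_peMr// exprn_ege1// ler1n.
- by rewrite !mulr_gt0 ?ltr0n ?fact_gt0// exprn_gt0// ltr0n.
- by rewrite !mulr_gt0 ?ltr0n ?fact_gt0.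
Qed.

Lemma exp_coeff_le_expR (x : R) n : 0 <= x -> x ^+ n / n`!%:R <= expR x.
Proof.
move=> x0; case: n => [|n].
  by rewrite expr0 divr1 -expR0 ler_expR.
by apply: le_trans (expR_ge1Dxn n x0); rewrite lerDr.
Qed.

Lemma entire_factor_coef q : (0 < q)%N -> entire (@factor_coef R q).
Proof.
move=> q0 r r0; exists (expR r) => n.
apply: le_trans (exp_coeff_le_expR n r0); rewrite mulrC ler_wpM2l ?exprn_ge0//.
rewrite ger0_norm ?factor_coef_ge0//; case: n => [|n].
  by rewrite /factor_coef /= invr1.
apply: le_trans (factor_coef_le _ _) _ => //.
rewrite ler_piMr// invf_le1 ?mulr_gt0 ?ltr0n//.
by rewrite -natrM ler1n muln_gt0 q0.
Qed.

(** The constant terms 1 and 1/q of the bracket combine with q / (q + 1) into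
    the constant coefficient 1 of the series. *)
Lemma calH_factorE q u : (0 < q)%N ->
  calH_factor q u = psum (@factor_coef R q) u.
Proof.
move=> q0; have qn0 : q%:R != 0 :> R by rewrite pnatr_eq0 -lt0n.
have qn1 : q.+1%:R != 0 :> R by rewrite pnatr_eq0.
rewrite /calH_factor; case: eqVneq => [->|u0].
  by rewrite psum0 /factor_coef /= -natr1; field; rewrite qn0 natr1.
have sumE n : pseries (@factor_coef R q) u n.+1 = q%:R / q.+1%:R *
    (1 + (series (exp_coeff (u / q%:R)) n.+2 - 1) / u).
  (* of the first two exponential terms, one cancels the subtracted 1 and
     the other gives 1/q after the division by u *)
  rewrite /pseries /series /= /exp_coeff /mk_sequence.
  rewrite [in RHS]big_nat_recl//= expr0 fact0 divr1 addrAC subrr add0r.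
  rewrite [in LHS]big_nat_recl// [in RHS]big_nat_recl//= expr0 mulr1.
  rewrite mulrDl addrA mulrDr; congr (_ + _).
    by rewrite /factor_coef /= expr1 divr1 -natr1; field; rewrite qn0 u0 natr1.
  rewrite mulr_suml mulr_sumr; apply: eq_bigr => k _.
  rewrite /factor_coef /= /ak expr_div_n !exprS.
  have kn0 : k.+2`!%:R != 0 :> R by rewrite pnatr_eq0 -lt0n fact_gt0.
  have qk0 : q%:R ^+ k != 0 :> R by rewrite expf_neq0.
  by field; rewrite kn0 qk0 qn0 u0 nat1r qn1.
apply/esym/cvg_lim => //; rewrite -cvg_shiftS.
rewrite (eq_cvg _ _ sumE).
apply: cvgMr; apply: cvgD; first exact: cvg_cst.
apply: cvgMl; apply: cvgB; last exact: cvg_cst.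
rewrite (cvg_shiftS (fun n => series (exp_coeff (u / q%:R)) n.+1)) cvg_shiftS.
exact: is_cvg_series_exp_coeff.
Qed.

(** A summable excess over 1: it makes the partial products bounded. *)
Lemma calH_factor_le (q : nat) (u : R) : (0 < q)%N -> 0 <= u ->
  calH_factor q u <= 1 + expR u * (q%:R * q.+1%:R)^-1.
Proof.
move=> q0 u0; rewrite calH_factorE//.
apply: limr_le; first exact/entire_cvg/entire_factor_coef.
exists 1%N => // -[//|n] _; rewrite /pseries /series /= big_nat_recl//.
rewrite {1}/factor_coef /= expr0 mulr1 lerD2l.
have cx := is_cvg_series_exp_coeff u.
have nd : nondecreasing_seq (series (exp_coeff u)).
  by apply/nondecreasing_series => k _ _; exact: exp_coeff_ge0.
apply: (@le_trans _ _ (series (exp_coeff u) n.+1 * (q%:R * q.+1%:R)^-1));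
  last first.
  rewrite ler_wpM2r ?invr_ge0 ?mulr_ge0//.
  exact: (nondecreasing_cvgn_le nd cx).
rewrite /series /= big_nat_recl// mulrDl -[leLHS]add0r lerD//.
  by rewrite mulr_ge0 ?exp_coeff_ge0// invr_ge0 mulr_ge0.
rewrite mulr_suml; apply: ler_sum => k _.
rewrite /exp_coeff /mk_sequence mulrC -mulrA ler_wpM2l ?exprn_ge0//.
exact: factor_coef_le.
Qed.

Definition partial_prod N (u : R) := \prod_(1 <= q < N.+1) calH_factor q u.

Lemma partial_prodE N u : entire (@partsum R N) /\
  partial_prod N u = psum (@partsum R N) u.
Proof.
elim: N => [|N [eN HN]].
  split.
    move=> r r0; exists 1 => n; rewrite partsum0.
    by case: n => [|n]; rewrite ?expr0 ?mulr1 ?normr1 ?normr0 ?mul0r.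
  rewrite /partial_prod big_geq//; apply/esym/cvg_lim => //.
  rewrite -cvg_shiftS /pseries /series /=.
  under eq_fun.
    move=> n; rewrite big_nat_recl// big1.
      by rewrite addr0 partsum0 expr0 mulr1; over.
    by move=> i _; rewrite partsum0 mul0r.
  exact: cvg_cst.
have -> : @partsum R N.+1 = cauchy_prod (@partsum R N) (@factor_coef R N.+1).
  by apply/funext => n; rewrite partsum_rec.
have ef := @entire_factor_coef N.+1 isT.
split; first exact: entire_cauchy_prod.
by rewrite psum_cauchy_prod// -HN -calH_factorE// /partial_prod big_nat_recr.
Qed.

Lemma entire_partsum N : entire (@partsum R N).
Proof. by case: (partial_prodE N 0). Qed.

(** By [1 + x <= expR x] the product is at most the exponential of
    [expR u] times a telescoping sum with value [1 - N.+1%:R^-1]. *)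
Lemma partial_prod_le N (u : R) : 0 <= u -> partial_prod N u <= expR (expR u).
Proof.
move=> u0.
apply: le_trans (_ : expR (expR u * (1 - N.+1%:R^-1)) <= _); last first.
  by rewrite ler_expR ler_piMr ?expR_ge0// lerBlDr lerDl invr_ge0.
have f0 q : (0 < q)%N -> 0 <= calH_factor q u.
  move=> q0; rewrite calH_factorE//.
  apply: le_trans (@term_le_psum _ _ _ 0%N _ _ u0).
  - by rewrite expr0 mulr1 factor_coef_ge0.
  - exact: entire_factor_coef.
  - by move=> k; exact: factor_coef_ge0.
elim: N => [|N IH].
  by rewrite /partial_prod big_geq// invr1 subrr mulr0 expR0.
rewrite /partial_prod big_nat_recr//=.
have -> : expR u * (1 - N.+2%:R^-1) =
    expR u * (1 - N.+1%:R^-1) + expR u * (N.+1%:R * N.+2%:R)^-1.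
  by field; rewrite -natrD nat1r !pnatr_eq0.
rewrite expRD ler_pM//.
- by rewrite big_nat; apply: prodr_ge0 => q /andP[q0 _]; exact: f0.
- exact: f0.
- by apply: le_trans (calH_factor_le _ _) _ => //; exact: expR_ge1Dx.
Qed.

Lemma partsum_le N n (u : R) : 0 <= u ->
  partsum N n * u ^+ n <= expR (expR u).
Proof.
move=> u0; apply: le_trans (partial_prod_le N u0).
have [eN ->] := partial_prodE N u.
by apply: term_le_psum => // k; exact: partsum_ge0.
Qed.

Lemma cvg_nd_bounded (v : R ^nat) M : nondecreasing_seq v ->
  (forall n, v n <= M) -> cvgn v.
Proof.
move=> nd vM; apply: nondecreasing_is_cvgn => //.
by exists M => _ [n _ <-].
Qed.

Lemma is_cvg_partsum n : cvgn (fun N => @partsum R N n).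
Proof.
apply: (@cvg_nd_bounded _ (expR (expR 1))); first exact: partsum_nd.
by move=> N; have := @partsum_le N n 1 ler01; rewrite expr1n mulr1.
Qed.

Definition partsum_lim n : R := limn (fun N => @partsum R N n).

Lemma partsum_le_lim N n : partsum N n <= partsum_lim n.
Proof.
exact: (nondecreasing_cvgn_le (@partsum_nd R n) (@is_cvg_partsum n) N).
Qed.

Lemma entire_partsum_lim : entire partsum_lim.
Proof.
move=> r r0; exists (expR (expR r)) => n.
rewrite ger0_norm; last exact: le_trans (partsum_ge0 0 n) (partsum_le_lim 0 n).
have : (fun N => partsum N n * r ^+ n) @ \oo --> partsum_lim n * r ^+ n.
  by apply: cvgMl; exact: is_cvg_partsum.
by move=> /cvgr_to_le; apply; apply: nearW => N; exact: partsum_le.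
Qed.

Lemma partial_prod_nd (u : R) : 0 <= u -> nondecreasing_seq (partial_prod^~ u).
Proof.
move=> u0 N M NM; rewrite !(partial_prodE _ _).2.
apply: lim_series_le; try exact/entire_cvg/entire_partsum.
by move=> n; rewrite ler_wpM2r ?exprn_ge0// partsum_nd.
Qed.

Lemma is_cvg_partial_prod (u : R) : 0 <= u -> cvgn (partial_prod^~ u).
Proof.
move=> u0; apply: (@cvg_nd_bounded _ (expR (expR u))).
  exact: partial_prod_nd.
by move=> N; exact: partial_prod_le.
Qed.

(** For [M >= N], [(partsum M n - partsum N n) * u ^+ n] is one term of the
    nonnegative series with sum [partial_prod M u - partial_prod N u]; then
    [M] tends to infinity. The bound is uniform in [n]. *)
Lemma partsum_tail N n (u : R) : 0 <= u ->
  (partsum_lim n - partsum N n) * u ^+ n <=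
  limn (partial_prod^~ u) - partial_prod N u.
Proof.
move=> u0.
have h : (fun M => (partsum M n - partsum N n) * u ^+ n) @ \oo -->
    (partsum_lim n - partsum N n) * u ^+ n.
  by apply: cvgMl; apply: cvgB; [exact: is_cvg_partsum|exact: cvg_cst].
apply: (cvgr_to_le h); near=> M.
have NM : (N <= M)%N by near: M; exact: nbhs_infty_ge.
have cP := is_cvg_partial_prod u0.
apply: (@le_trans _ _ (partial_prod M u - partial_prod N u)); last first.
  by rewrite lerD2r (nondecreasing_cvgn_le (partial_prod_nd u0) cP M).
rewrite !(partial_prodE _ _).2 -psumB; try exact: entire_partsum.
have ge0 k : 0 <= @partsum R M k - partsum N k by rewrite subr_ge0 partsum_nd.
apply: (@term_le_psum _ (fun k => partsum M k - partsum N k)) => //.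
move=> r r0; exists (expR (expR r)) => k; rewrite ger0_norm//.
apply: le_trans (partsum_le M k r0).
by rewrite ler_wpM2r ?exprn_ge0// gerBl partsum_ge0.
Unshelve. all: by end_near. Qed.

Lemma cvg_partial_prod (u : R) : partial_prod^~ u @ \oo --> psum partsum_lim u.
Proof.
pose r := 2 * `|u|; have r0 : 0 <= r by rewrite mulr_ge0.
have cP := is_cvg_partial_prod r0.
apply/cvgrPdist_le => e e0.
have e20 : 0 < e / 2 by rewrite divr_gt0.
have /cvgrPdist_le/(_ _ e20) := cP; apply: filterS => N hN.
rewrite (partial_prodE N u).2 -psumB; first last.
- exact: entire_partsum.
- exact: entire_partsum_lim.
have [|_] := @psum_bound R (fun n => partsum_lim n - partsum N n) u (e / 2).
  move=> n; rewrite ger0_norm ?subr_ge0 ?partsum_le_lim//.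
  apply: le_trans (partsum_tail N n r0) _.
  exact: le_trans (ler_norm _) hN.
by rewrite mulrC divfK.
Qed.

Lemma calH_psum : @calH R = psum partsum_lim.
Proof.
apply/funext => u; apply/cvg_lim => //; rewrite -cvg_shiftS.
exact: cvg_partial_prod.
Qed.

Lemma taylor_coef_calH n : taylor_coef (@calH R) n = partsum_lim n.
Proof. by rewrite calH_psum taylor_coef_psum//; exact: entire_partsum_lim. Qed.

End Product.

(** * The infinite sum over tuples as a limit *)

Section Tuples.
Context {R : realType}.

(** An enumeration following the recursion of [distinct_sum]. *)
Fixpoint arrangements (d : nat) (A : seq nat) : seq (seq nat) :=
  if d is d'.+1 then [seq q :: t | q <- A, t <- arrangements d' (rem q A)]
  else [:: [::]].

Lemma mem_arrangements d A t : uniq A ->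
  (t \in arrangements d A) = [&& size t == d, uniq t & all (mem A) t].
Proof.
elim: d A t => [|d IH] A t uA /=; first by rewrite inE; case: t.
apply/allpairsPdep/and3P => [[q [s [qA]]]|].
  rewrite IH ?rem_uniq// => /and3P[/eqP <- us sA] ->.
  have {}sA x : x \in s -> (x != q) && (x \in A).
    by move=> /(allP sA) /=; rewrite mem_rem_uniq// !inE.
  split=> //=.
    by rewrite us andbT; apply/negP => /sA; rewrite eqxx.
  by rewrite qA; apply/allP => x /sA /andP[].
case: t => [[]//|q s] [/= ss /andP[qs us] /andP[qA sA]].
exists q, s; split=> //; rewrite IH ?rem_uniq//; apply/and3P; split=> //.
apply/allP => x xs; rewrite /= mem_rem_uniq// !inE.
have -> : x \in A := allP sA _ xs; rewrite andbT.
by apply: contraNneq qs => <-.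
Qed.

Lemma arrangements_uniq d A : uniq A -> uniq (arrangements d A).
Proof.
elim: d A => [//|d IH] A uA /=; apply: allpairs_uniq_dep => //.
  by move=> q qA; apply: IH; rewrite rem_uniq.
by move=> [q s] [q' s'] _ _ /= [-> ->].
Qed.

Lemma sum_arrangements nu A :
  \sum_(t <- arrangements (size nu) A)
     \prod_(s < size nu) ak R (nth 0%N nu s) (nth 0%N t s) = distinct_sum nu A.
Proof.
elim: nu A => [|k nu IH] A /=; first by rewrite big_seq1 big_ord0.
rewrite big_allpairs_dep; apply: eq_bigr => q _.
rewrite -IH mulr_sumr; apply: eq_bigr => t _.
by rewrite big_ord_recl.
Qed.

Definition tuple_arrangements d A : seq (d.-tuple nat) :=
  pmap insub (arrangements d A).

Lemma tuple_arrangements_uniq d A : uniq A -> uniq (tuple_arrangements d A).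
Proof. by move=> uA; rewrite pmap_sub_uniq// arrangements_uniq. Qed.

Lemma mem_tuple_arrangements d A (t : d.-tuple nat) : uniq A ->
  (t \in tuple_arrangements d A) = uniq t && all (mem A) t.
Proof.
by move=> uA; rewrite mem_pmap_sub mem_arrangements//= size_tuple eqxx.
Qed.

Lemma sum_tuple_arrangements nu A : uniq A ->
  \sum_(q <- tuple_arrangements (size nu) A)
     \prod_(s < size nu) ak R (nth 0%N nu s) (tnth q s) = distinct_sum nu A.
Proof.
move=> uA; rewrite -sum_arrangements.
have <- : map val (tuple_arrangements (size nu) A) = arrangements (size nu) A.
  rewrite (pmap_filter (insubK _)); apply/all_filterP/allP => t.
  by rewrite mem_arrangements// => /and3P[st _ _]; rewrite insubT.
rewrite big_map; apply: eq_bigr => q _; apply: eq_bigr => s _.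
by rewrite (tnth_nth 0%N).
Qed.

Lemma ler_sum_subseq (T : eqType) (s1 s2 : seq T) (f : T -> R) :
  uniq s1 -> uniq s2 -> {subset s1 <= s2} -> (forall x, 0 <= f x) ->
  \sum_(x <- s1) f x <= \sum_(x <- s2) f x.
Proof.
move=> u1 u2 s12 f0; rewrite [leRHS](bigID (mem s1)) /= -[leLHS]addr0.
apply: lerD; last by apply: sumr_ge0.
rewrite -[leRHS]big_filter.
suff p : perm_eq s1 [seq x <- s2 | x \in s1] by rewrite (perm_big _ p).
apply: uniq_perm; rewrite ?filter_uniq// => x.
by rewrite mem_filter /=; case: (boolP (x \in s1)) => // /s12 ->.
Qed.

Lemma downto_uniq N : uniq (downto N).
Proof. by rewrite rev_uniq iota_uniq. Qed.

Lemma is_cvg_Cpart_upto n nu : is_partition n nu -> cvgn (@Cpart_upto R ^~ nu).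
Proof.
move=> nuP; apply: (@cvg_nd_bounded _ _ (expR (expR 1))).
  exact: Cpart_upto_nd.
move=> N; have := @partsum_le R N n 1 ler01; rewrite expr1n mulr1.
apply: le_trans; rewrite /partsum (big_rem nu) ?mem_parts//= lerDl.
by apply: sumr_ge0 => mu _; exact: Cpart_upto_ge0.
Qed.

(** A finite set of tuples has bounded entries, hence is contained in some
    [tuple_arrangements _ (downto N)], which is itself finite. So the supremum
    of the finite sums is the limit of the sums over these arrangements, and
    this limit is finite by the uniform bound on [partsum]. *)
Lemma cvg_Cpart n nu : is_partition n nu ->
  @Cpart_upto R ^~ nu @ \oo --> Cpart R nu.
Proof.
move=> nuP; have cU := is_cvg_Cpart_upto nuP.
suff -> : Cpart R nu = limn (@Cpart_upto R ^~ nu) by [].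
have w0 := @mult_fact_gt0 R nu.
pose L : R := limn (@Cpart_upto R ^~ nu).
rewrite /Cpart -/(@mult_fact R nu); set E := esum _ _.
have dsE N : distinct_sum nu (downto N) = mult_fact nu * Cpart_upto N nu :> R.
  by rewrite /Cpart_upto mulVKf// gt_eqF.
have F0 (q : (size nu).-tuple nat) :
    0 <= \prod_(s < size nu) ak R (nth 0%N nu s) (tnth q s).
  by apply: prodr_ge0 => s _; exact: ak_ge0.
have EL : (E <= (mult_fact nu * L)%:E)%E.
  apply: ub_ereal_sup => _ [X [fX XD] <-].
  rewrite fsbig_finite//= sumEFin lee_fin.
  pose N := (\max_(t <- fset_set X) sumn (t : (size nu).-tuple nat))%N.
  apply: (@le_trans _ _ (mult_fact nu * Cpart_upto N nu)); last first.
    rewrite ler_pM2l//.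
    exact: (nondecreasing_cvgn_le (@Cpart_upto_nd R nu) cU N).
  rewrite -dsE -sum_tuple_arrangements ?downto_uniq//.
  apply: ler_sum_subseq => //; first exact: fset_uniq.
    by rewrite tuple_arrangements_uniq// downto_uniq.
  move=> t tX; rewrite mem_tuple_arrangements ?downto_uniq//.
  have /XD[ut t0] : X t by move: tX; rewrite in_fset_set// inE.
  rewrite ut /=; apply/allP => q qt /=.
  rewrite mem_downto; have /tnthP[s qE] := qt; rewrite {1}qE t0/=.
  apply: leq_trans (mem_leq_sumn qt) _.
  by apply: (@leq_bigmax_seq _ _ _
    (fun t : (size nu).-tuple nat => sumn t)).
have E0 : (0 <= E)%E by apply: esum_ge0 => q _; rewrite lee_fin.
have Efin : E \is a fin_num.
  by rewrite ge0_fin_numE// (le_lt_trans EL)// ltry.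
have LE : mult_fact nu * L <= fine E.
  have cD : (fun N => mult_fact nu * Cpart_upto N nu) @ \oo -->
      mult_fact nu * L.
    by apply: cvgMr.
  apply: (cvgr_to_le cD); apply: nearW => N; rewrite -lee_fin fineK// -dsE.
  rewrite -sum_tuple_arrangements ?downto_uniq//.
  apply: esum_ge; exists [set` tuple_arrangements (size nu) (downto N)].
    split; first exact: finite_seq.
    move=> t /=; rewrite mem_tuple_arrangements ?downto_uniq//.
    move=> /andP[ut /allP tN]; split=> // s.
    by have /tN := mem_tnth s t; rewrite /= mem_downto => /andP[].
  rewrite -fsbig_seq ?sumEFin//.
  by rewrite tuple_arrangements_uniq// downto_uniq.
have -> : fine E = mult_fact nu * L.
  by apply/eqP; rewrite eq_le LE andbT -lee_fin fineK.
by rewrite mulKf// gt_eqF.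
Qed.

Lemma Cr_sum_parts r : Cr R r = \sum_(nu <- parts r.-1) Cpart R nu.
Proof.
rewrite /Cr taylor_coef_calH; apply/cvg_lim => //.
rewrite /partsum big_seq; under eq_fun do rewrite big_seq.
apply: cvg_big => [|nu]; first exact: add_continuous.
by rewrite mem_parts; exact: cvg_Cpart.
Qed.

End Tuples.

(** * The one-part partition and the zeta values *)

Section Hook.
Context {R : realType}.

Definition hook_sum (k N : nat) : R :=
  \sum_(1 <= q < N.+1) (q%:R ^+ k * q.+1%:R)^-1.

Lemma is_partition1 k : (0 < k)%N -> is_partition k [:: k].
Proof.
by move=> k0; rewrite /is_partition /= inE addn0 eqxx andbT eq_sym -lt0n.
Qed.

Lemma Cpart_upto1 N k : Cpart_upto N [:: k] = (k.+1`!%:R)^-1 * hook_sum k N.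
Proof.
rewrite /Cpart_upto; have -> : @mult_fact R [:: k] = 1.
  rewrite /mult_fact big1// => j _.
  by rewrite /multiplicity /= addn0; case: eqP.
rewrite invr1 mul1r /= /downto (perm_big _ (permEl (perm_rev _))) /=.
rewrite /hook_sum /index_iota subn1 mulr_sumr; apply: eq_bigr => q _.
by rewrite mulr1 /ak -mulrA invfM.
Qed.

Lemma cvg_hook_sum k : (0 < k)%N ->
  hook_sum k @ \oo --> k.+1`!%:R * Cpart R [:: k].
Proof.
move=> k0; have fn0 : k.+1`!%:R != 0 :> R by rewrite pnatr_eq0 -lt0n fact_gt0.
have -> : hook_sum k = (fun N => k.+1`!%:R * Cpart_upto N [:: k]).
  by apply/funext => N; rewrite Cpart_upto1 mulVKf.
by apply: cvgMr; exact: cvg_Cpart (is_partition1 k0).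
Qed.

Lemma hook_sum1 N : hook_sum 1 N = 1 - N.+1%:R^-1.
Proof.
rewrite /hook_sum; elim: N => [|N IH].
  by rewrite big_geq// invr1 subrr.
rewrite big_nat_recr//= IH expr1.
by field; rewrite -natrD nat1r !pnatr_eq0.
Qed.

Lemma hook_sumS k N :
  hook_sum k.+1 N + hook_sum k N = \sum_(1 <= q < N.+1) q%:R `^ (- k.+1%:R).
Proof.
rewrite -big_split /= !big_nat; apply: eq_bigr => q /andP[q0 _].
have qn0 : q%:R != 0 :> R by rewrite pnatr_eq0 -lt0n.
rewrite powRN powR_mulrn// exprS.
have qk0 : q%:R ^+ k != 0 :> R by rewrite expf_neq0.
by field; rewrite qk0 qn0 nat1r pnatr_eq0.
Qed.

Lemma hook_zeta k : (0 < k)%N ->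
  k.+2`!%:R * Cpart R [:: k.+1] + k.+1`!%:R * Cpart R [:: k] =
  riemann_zeta k.+1%:R.
Proof.
move=> k0; apply/esym/cvg_lim => //; rewrite -cvg_shiftS /=.
under eq_fun do rewrite -hook_sumS.
by apply: cvgD; exact: cvg_hook_sum.
Qed.

Lemma Cpart_one_part k : (0 < k)%N -> Cpart R [:: k] = rho R k.+1.
Proof.
move=> k0; have fn0 n : n`!%:R != 0 :> R by rewrite pnatr_eq0 -lt0n fact_gt0.
suff H : k.+1`!%:R * Cpart R [:: k] =
    (-1) ^+ k.+1 + \sum_(3 <= j < k.+2) (-1) ^+ (k.+1 + j) *
      riemann_zeta (j.-1%:R : R).
  by rewrite /rho -H mulKf.
case: k k0 => [//|k _]; elim: k => [|k IH].
  rewrite big_geq// addr0 sqrrN expr1n.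
  have h : hook_sum 1 @ \oo --> (1 : R).
    rewrite (eq_cvg _ _ hook_sum1) -[1 in X in _ --> X]subr0.
    by apply: cvgB; [exact: cvg_cst|exact: cvg_harmonic].
  apply: etrans (cvg_lim _ h) => //; apply/esym/cvg_lim => //.
  exact: cvg_hook_sum.
rewrite big_nat_recr//=.
have -> : \sum_(3 <= j < k.+3) (-1) ^+ (k.+3 + j) * riemann_zeta (j.-1%:R : R) =
    - \sum_(3 <= j < k.+3) (-1) ^+ (k.+2 + j) * riemann_zeta (j.-1%:R : R).
  by rewrite -sumrN; apply: eq_bigr => j _; rewrite addSn exprS mulN1r mulNr.
(* the new term, j = k.+3, has an even exponent and brings in zeta(k.+2) *)
have -> : (-1 : R) ^+ (k.+3 + k.+3) = 1.
  by rewrite addnn -mul2n exprM sqrrN !expr1n.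
rewrite -hook_zeta// IH exprS.
by ring.
Qed.

End Hook.

(** * The theorem *)

Lemma sum_other_partitions (R : realType) (n : nat) (f : seq nat -> R) :
  (0 < n)%N ->
  \sum_(nu <- parts n) f nu = f [:: n] +
    \sum_(nu \in [set nu | is_partition n nu /\ (2 <= size nu)%N]) f nu.
Proof.
move=> n0; rewrite (bigD1_seq [:: n]) ?parts_uniq//=; last first.
  by rewrite mem_parts is_partition1.
congr (_ + _).
have -> : [set nu | is_partition n nu /\ (2 <= size nu)%N] =
    [set` [seq nu <- parts n | (2 <= size nu)%N]].
  apply/seteqP; split=> nu /=; rewrite mem_filter mem_parts.
    by move=> [-> ->].
  by move=> /andP[].
rewrite -fsbig_seq ?filter_uniq ?parts_uniq// big_filter.
rewrite big_seq_cond [RHS]big_seq_cond; apply: eq_bigl => nu.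
rewrite mem_parts; case: (boolP (is_partition n nu)) => //= /and3P[_ _].
case: nu => [|a [|b nu]] /=; first by rewrite eq_sym (gtn_eqF n0).
  by rewrite addn0 => /eqP ->; rewrite eqxx.
by move=> _; apply/eqP.
Qed.

Theorem corollary4p3 (R : realType) (r : nat) (hr : (2 <= r)%N) :
  Cpart R [:: r.-1] = rho R r /\
  Cr R r - rho R r =
    \sum_(nu \in [set nu : seq nat | is_partition r.-1 nu /\ (2 <= size nu)%N])
      Cpart R nu.
Proof.
have r1 : (0 < r.-1)%N by case: r hr => [|[]].
have hook : Cpart R [:: r.-1] = rho R r.
  by rewrite Cpart_one_part// prednK// ltnW.
split=> //.
by rewrite Cr_sum_parts (sum_other_partitions _ r1) hook addrAC subrr add0r.
Qed.
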